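(* Let $(\mathcal P,\Delta_{\mathcal P},H,B,\iota,(\chi_i,J_i)_{i\in I})$ be a locally trivial quantum principal fibre bundle (QPFB), let $i,j\in I$, and put $\mathcal P_{ij}:=\mathcal P/(\ker\chi_i+\ker\chi_j)$ and $B_{ij}:=B/(J_i+J_j)$. Then $\mathcal P_{ij}$ is a trivial QPFB with base $B_{ij}$ and structure group $H$; i.e. there exist algebra homomorphisms $$\chi^i_{ij}:\mathcal P_{ij}\to B_{ij}\otimes H,\qquad \Delta_{\mathcal P_{ij}}:\mathcal P_{ij}\to\mathcal P_{ij}\otimes H,\qquad \iota_{ij}:B_{ij}\to\mathcal P_{ij}$$ such that $\Delta_{\mathcal P_{ij}}$ is a right $H$-coaction, $\chi^i_{ij}$ is an isomorphism, $\iota_{ij}$ is injective, $(\chi^i_{ij}\otimes \mathrm{id})\circ\Delta_{\mathcal P_{ij}}=(\mathrm{id}\otimes\Delta)\circ\chi^i_{ij}$, $\chi^i_{ij}\circ\iota_{ij}(a)=a\otimes 1$ for all $a\in B_{ij}$, and $\iota_{ij}(B_{ij})=\{f\in\mathcal P_{ij}\mid \Delta_{\mathcal P_{ij}}(f)=f\otimes 1\}$.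
   Context: All algebras are associative and unital over $\mathbb C$; ideals are two-sided; $H$ is a Hopf algebra over $\mathbb C$ with coproduct $\Delta$, counit $\varepsilon$ and invertible antipode $S$. A covering of an algebra $B$ is a finite family $(J_i)_{i\in I}$ of ideals with $\bigcap_i J_i=0$. Put $B_i=B/J_i$, $B_{ij}=B/(J_i+J_j)$, with canonical projections $\pi_i:B\to B_i$, $\pi^i_j:B_i\to B_{ij}$. The covering is complete if $b\mapsto (b+J_i)_{i\in I}$ maps $B$ onto $B_c=\{(b_i)_i\in\bigoplus_i B_i\mid \pi^i_j(b_i)=\pi^j_i(b_j)\ \forall i\ne j\}$. A right $H$-comodule algebra is an algebra $\mathcal P$ with an algebra homomorphism $\Delta_{\mathcal P}:\mathcal P\to\mathcal P\otimes H$ (right coaction) with $(\Delta_{\mathcal P}\otimes\mathrm{id})\Delta_{\mathcal P}=(\mathrm{id}\otimes\Delta)\Delta_{\mathcal P}$ and $(\mathrm{id}\otimes\varepsilon)\Delta_{\mathcal P}=\mathrm{id}$. A locally trivial QPFB is a tuple $(\mathcal P,\Delta_{\mathcal P},H,B,\iota,(\chi_i,J_i)_{i\in I})$ where $B$ is an algebra, $H$ a Hopf algebra, $\mathcal P$ a right $H$-comodule algebra with coaction $\Delta_{\mathcal P}$, $(J_i)_{i\in I}$ a complete covering of $B$, $\chi_i:\mathcal P\to B_i\otimes H$ surjective homomorphisms and $\iota:B\to\mathcal P$ an injective homomorphism with: $(\mathrm{id}\otimes\Delta)\circ\chi_i=(\chi_i\otimes\mathrm{id})\circ\Delta_{\mathcal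 P}$; $\chi_i\circ\iota(a)=\pi_i(a)\otimes1$ for $a\in B$; $(\ker\chi_i)_{i\in I}$ is a complete covering of $\mathcal P$; $\iota(B)=\{f\in\mathcal P\mid\Delta_{\mathcal P}(f)=f\otimes1\}$. It is called trivial if there is an isomorphism $\chi:\mathcal P\to B\otimes H$ with $\chi\circ\iota=\mathrm{id}\otimes1$ and $(\chi\otimes\mathrm{id})\circ\Delta_{\mathcal P}=(\mathrm{id}\otimes\Delta)\circ\chi$. *)

(* Defs.v *)
From HB Require Import structures.
From mathcomp Require Import all_boot all_order all_algebra.
From mathcomp Require Import finmap boolp reals complex.
From mathcomp.multinomials Require Import monalg.

Set Implicit Arguments.
Unset Strict Implicit.
Unset Printing Implicit Defensive.

Import GRing.Theory.
Local Open Scope ring_scope.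
Local Open Scope quotient_scope.

(* The structure algType of ssralg entails 1 != 0, but a quotient such as
   B / (J_i + J_j) may be the zero algebra; hence this variant of algType for
   possibly zero rings. Hierarchy-Builder does not accept it as an extension of
   both pzRingType and lmodType, so the ring structure is derived below. *)
HB.mixin Record Lmodule_isPzAlgebra (F : fieldType) A
    of GRing.Lmodule F A := {
  amul : A -> A -> A;
  aone : A;
  amulA : associative amul;
  amul1l : left_id aone amul;
  amul1r : right_id aone amul;
  amulDl : left_distributive amul +%R;
  amulDr : right_distributive amul +%R;
  amulZl : forall (c : F) u v, amul (c *: u) v = c *: amul u v;
  amulZr : forall (c : F) u v, amul u (c *: v) = c *: amul u v
}.

#[short(type="pzAlgType")]
HB.structure Definition PzAlgebra (F : fieldType) :=
  {A of GRing.Lmodule F A & Lmodule_isPzAlgebra F A}.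

HB.instance Definition _ (F : fieldType) (A : pzAlgType F) :=
  GRing.Zmodule_isPzRing.Build (PzAlgebra.sort A)
    (@amulA F A) (@amul1l F A) (@amul1r F A) (@amulDl F A) (@amulDr F A).

HB.instance Definition _ (F : fieldType) :=
  @Lmodule_isPzAlgebra.Build F F^o *%R 1
    (@mulrA F) (@mul1r F) (@mulr1 F) (@mulrDl F) (@mulrDr F)
    (fun c u v => esym (mulrA c u v)) (fun c u v => mulrCA u c v).

Record alghom (F : fieldType) (A B : pzAlgType F) := AlgHom {
  alghom_fun :> {linear A -> B};
  alghomP : monoid_morphism alghom_fun }.

Record submodule (F : fieldType) (V : lmodType F) := Submodule {
  submod_pred :> {pred V};
  submod_closedP : submod_closed submod_pred }.

HB.instance Definition _ (F : fieldType) (V : lmodType F) (N : submodule V) :=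
  GRing.isZmodClosed.Build V (submod_pred N)
    (GRing.submod_closedB (submod_closedP N)).

Definition vquot (F : fieldType) (V : lmodType F) (N : submodule V) : Type :=
  Quotient.quot (submod_pred N).

HB.instance Definition _ (F : fieldType) (V : lmodType F) (N : submodule V) :=
  GRing.Zmodule.copy (vquot N) (Quotient.quot (submod_pred N)).

Section QuotientSpace.
Variables (F : fieldType) (V : lmodType F) (N : submodule V).

Lemma submodZ (c : F) (x : V) : x \in N -> c *: x \in N.
Proof.
have [N0 Nlin] := submod_closedP N.
by move=> Nx; rewrite -[c *: x]addr0; apply: Nlin.
Qed.

Definition vproj (x : V) : vquot N := \pi_(Quotient.quot (submod_pred N)) x.
Definition vrepr (q : vquot N) : V := repr (q : Quotient.quot (submod_pred N)).

Lemma vreprK : cancel vrepr vproj.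
Proof. exact: reprK. Qed.

Lemma vproj_surj (q : vquot N) : {x | vproj x = q}.
Proof. by exists (vrepr q); rewrite vreprK. Qed.

Lemma vprojD : {morph vproj : x y / x + y}.
Proof. by move=> x y; rewrite /vproj Quotient.pi_add. Qed.

Lemma vproj_eq x y : (vproj x == vproj y) = (x - y \in N).
Proof. by rewrite Quotient.idealrBE. Qed.

Definition vquot_scale (c : F) (q : vquot N) : vquot N := vproj (c *: vrepr q).

Lemma vprojZ c x : vproj (c *: x) = vquot_scale c (vproj x).
Proof.
by apply/eqP; rewrite vproj_eq -scalerBr submodZ // -vproj_eq vreprK.
Qed.

Lemma vquot_scalerA a b q :
  vquot_scale a (vquot_scale b q) = vquot_scale (a * b) q.
Proof. by case: (vproj_surj q) => x <-; rewrite -!vprojZ scalerA. Qed.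

Lemma vquot_scale1r : left_id 1 vquot_scale.
Proof. by move=> q; case: (vproj_surj q) => x <-; rewrite -!vprojZ scale1r. Qed.

Lemma vquot_scalerDr : right_distributive vquot_scale +%R.
Proof.
move=> a p q; case: (vproj_surj p) (vproj_surj q) => x <- [y <-].
by rewrite -vprojD -!vprojZ -vprojD scalerDr.
Qed.

Lemma vquot_scalerDl q : {morph vquot_scale^~ q : a b / a + b}.
Proof.
move=> a b; case: (vproj_surj q) => x <-.
by rewrite -!vprojZ -vprojD scalerDl.
Qed.

HB.instance Definition _ := GRing.Zmodule_isLmodule.Build F (vquot N)
  vquot_scalerA vquot_scale1r vquot_scalerDr vquot_scalerDl.

Lemma vproj_linear : linear vproj.
Proof. by move=> a x y; rewrite vprojD vprojZ. Qed.

HB.instance Definition _ :=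
  GRing.isLinear.Build F V (vquot N) _ vproj vproj_linear.

Lemma vproj_eq0 x : (vproj x == 0) = (x \in N).
Proof. by rewrite -(linear0 vproj) vproj_eq subr0. Qed.

Section Lift.
Variables (W : lmodType F) (f : {linear V -> W}).
Hypothesis fN : forall x, x \in N -> f x = 0.

Lemma vlift_proj x : f (vrepr (vproj x)) = f x.
Proof.
apply/eqP; rewrite -subr_eq0 -linearB; apply/eqP/fN.
by rewrite -vproj_eq vreprK.
Qed.

Lemma vlift_linear : linear (f \o vrepr).
Proof.
move=> a p q; case: (vproj_surj p) (vproj_surj q) => x <- [y <-] /=.
by rewrite -linearP !vlift_proj linearP.
Qed.
End Lift.
End QuotientSpace.

Record ideal (F : fieldType) (A : pzAlgType F) := Ideal {
  ideal_submod :> submodule A;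
  idealMl : forall a x, x \in ideal_submod -> a * x \in ideal_submod;
  idealMr : forall a x, x \in ideal_submod -> x * a \in ideal_submod }.

Definition quot (F : fieldType) (A : pzAlgType F) (J : ideal A) : Type :=
  vquot J.

HB.instance Definition _ (F : fieldType) (A : pzAlgType F) (J : ideal A) :=
  GRing.Lmodule.copy (quot J) (vquot J).

Section QuotientAlgebra.
Variables (F : fieldType) (A : pzAlgType F) (J : ideal A).

Definition proj (x : A) : quot J := vproj J x.
HB.instance Definition _ :=
  GRing.isLinear.Build F A (quot J) _ proj (vproj_linear J).

Definition quot_repr (q : quot J) : A := vrepr q.

Lemma quot_reprK : cancel quot_repr proj.
Proof. exact: vreprK. Qed.

Lemma proj_surj (q : quot J) : {x | proj x = q}.
Proof. exact: vproj_surj. Qed.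

Lemma proj_eq x y : (proj x == proj y) = (x - y \in J).
Proof. exact: vproj_eq. Qed.

Definition quot_mul (p q : quot J) : quot J := proj (quot_repr p * quot_repr q).
Definition quot_one : quot J := proj 1.

Lemma projM x y : proj (x * y) = quot_mul (proj x) (proj y).
Proof.
apply/eqP; rewrite proj_eq; set x' := quot_repr _; set y' := quot_repr _.
have -> : x * y - x' * y' = (x - x') * y + x' * (y - y').
  by rewrite mulrBl mulrBr addrA subrK.
have xJ : x - x' \in J by rewrite -proj_eq quot_reprK.
have yJ : y - y' \in J by rewrite -proj_eq quot_reprK.
have [_ Jlin] := submod_closedP J.
by rewrite -[X in X + _]scale1r; apply: Jlin; [apply: idealMr|apply: idealMl].
Qed.

Lemma quot_mulA : associative quot_mul.
Proof.
move=> p q r.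
case: (proj_surj p) (proj_surj q) (proj_surj r) => x <- [y <-] [z <-].
by rewrite -!projM mulrA.
Qed.

Lemma quot_mul1l : left_id quot_one quot_mul.
Proof. by move=> p; case: (proj_surj p) => x <-; rewrite -projM mul1r. Qed.

Lemma quot_mul1r : right_id quot_one quot_mul.
Proof. by move=> p; case: (proj_surj p) => x <-; rewrite -projM mulr1. Qed.

Lemma quot_mulDl : left_distributive quot_mul +%R.
Proof.
move=> p q r.
case: (proj_surj p) (proj_surj q) (proj_surj r) => x <- [y <-] [z <-].
by rewrite -linearD -!projM mulrDl linearD.
Qed.

Lemma quot_mulDr : right_distributive quot_mul +%R.
Proof.
move=> p q r.
case: (proj_surj p) (proj_surj q) (proj_surj r) => x <- [y <-] [z <-].
by rewrite -linearD -!projM mulrDr linearD.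
Qed.

Lemma quot_mulZl (c : F) p q : quot_mul (c *: p) q = c *: quot_mul p q.
Proof.
case: (proj_surj p) (proj_surj q) => x <- [y <-].
by rewrite -linearZ_LR -!projM -linearZ_LR; congr (proj _); apply: amulZl.
Qed.

Lemma quot_mulZr (c : F) p q : quot_mul p (c *: q) = c *: quot_mul p q.
Proof.
case: (proj_surj p) (proj_surj q) => x <- [y <-].
by rewrite -linearZ_LR -!projM -linearZ_LR; congr (proj _); apply: amulZr.
Qed.

HB.instance Definition _ := Lmodule_isPzAlgebra.Build F (quot J)
  quot_mulA quot_mul1l quot_mul1r quot_mulDl quot_mulDr quot_mulZl quot_mulZr.
End QuotientAlgebra.

Section Ideals.
Variables (F : fieldType) (A : pzAlgType F).
Implicit Types J K : ideal A.

Definition ideal_sum_pred J K : {pred A} :=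
  fun x => `[< exists y z, [/\ y \in J, z \in K & x = y + z] >].

Lemma ideal_sum_closed J K : submod_closed (ideal_sum_pred J K).
Proof.
have [J0 Jlin] := submod_closedP J; have [K0 Klin] := submod_closedP K.
split; first by apply/asboolP; exists 0, 0; rewrite addr0.
move=> a _ _ /asboolP[y [z [Jy Kz ->]]] /asboolP[y' [z' [Jy' Kz' ->]]].
apply/asboolP; exists (a *: y + y'), (a *: z + z').
by split; [apply: Jlin|apply: Klin|rewrite scalerDr addrACA].
Qed.

Lemma ideal_sumMl J K a x :
  x \in ideal_sum_pred J K -> a * x \in ideal_sum_pred J K.
Proof.
move=> /asboolP[y [z [Jy Kz ->]]]; apply/asboolP; exists (a * y), (a * z).
by rewrite mulrDr; split=> //; apply: idealMl.
Qed.

Lemma ideal_sumMr J K a x :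
  x \in ideal_sum_pred J K -> x * a \in ideal_sum_pred J K.
Proof.
move=> /asboolP[y [z [Jy Kz ->]]]; apply/asboolP; exists (y * a), (z * a).
by rewrite mulrDl; split=> //; apply: idealMr.
Qed.

Definition ideal_sum J K : ideal A :=
  @Ideal F A (Submodule (ideal_sum_closed J K))
    (@ideal_sumMl J K) (@ideal_sumMr J K).

Lemma ideal_suml J K : {subset J <= ideal_sum J K}.
Proof.
have [K0 _] := submod_closedP K.
by move=> x Jx; apply/asboolP; exists x, 0; rewrite addr0.
Qed.

Lemma ideal_sumr J K : {subset K <= ideal_sum J K}.
Proof.
have [J0 _] := submod_closedP J.
by move=> x Kx; apply/asboolP; exists 0, x; rewrite add0r.
Qed.

(* The canonical map A / J -> A / K for J contained in K. *)
Definition quot_map J K (JK : {subset J <= K}) (q : quot J) : quot K :=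
  proj K (quot_repr q).

Lemma quot_map_proj J K (JK : {subset J <= K}) x :
  quot_map JK (proj J x) = proj K x.
Proof.
by apply/eqP; rewrite proj_eq; apply: JK; rewrite -proj_eq quot_reprK.
Qed.

Section Kernel.
Variables (B : pzAlgType F) (f : alghom A B).

Definition ker_pred : {pred A} := fun x => f x == 0.

Lemma ker_closed : submod_closed ker_pred.
Proof.
split=> [|a x y /eqP fx /eqP fy]; first by rewrite unfold_in /= linear0.
by rewrite unfold_in /= linearP fx fy scaler0 addr0.
Qed.

Lemma kerMl a x : x \in ker_pred -> a * x \in ker_pred.
Proof.
by move=> /eqP fx; rewrite unfold_in /= (alghomP f).2 fx mulr0.
Qed.

Lemma kerMr a x : x \in ker_pred -> x * a \in ker_pred.
Proof.
by move=> /eqP fx; rewrite unfold_in /= (alghomP f).2 fx mul0r.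
Qed.

Definition ker_ideal : ideal A := @Ideal F A (Submodule ker_closed) kerMl kerMr.
End Kernel.

Variables (I : finType) (J : I -> ideal A).

Definition covering : Prop := forall a : A, (forall i, a \in J i) -> a = 0.

Definition complete_covering : Prop :=
  covering /\
  forall a : forall i, quot (J i),
    (forall i j, i != j ->
       quot_map (@ideal_suml (J i) (J j)) (a i)
       = quot_map (@ideal_sumr (J i) (J j)) (a j)) ->
    exists b : A, forall i, proj (J i) b = a i.
End Ideals.

Section TensorProduct.
Variables (F : fieldType) (A B : lmodType F).

(* The tensor product is the free vector space on A * B, in which << (a, b) >>
   is the basis vector at (a, b), modulo the bilinearity relations. *)
Inductive tensor_rel : {malg F[(A * B)%type]} -> Prop :=
| TensorRel0 : tensor_rel 0
| TensorRelP c x y : tensor_rel x -> tensor_rel y -> tensor_rel (c *: x + y)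
| TensorRelDl a a' b :
    tensor_rel (<< (a + a', b) >> - (<< (a, b) >> + << (a', b) >>))
| TensorRelDr a b b' :
    tensor_rel (<< (a, b + b') >> - (<< (a, b) >> + << (a, b') >>))
| TensorRelZl c a b : tensor_rel (<< (c *: a, b) >> - c *: << (a, b) >>)
| TensorRelZr c a b : tensor_rel (<< (a, c *: b) >> - c *: << (a, b) >>).

Definition tensor_pred : {pred {malg F[(A * B)%type]}} :=
  fun x => `[< tensor_rel x >].

Lemma tensor_closed : submod_closed tensor_pred.
Proof.
split; first by apply/asboolP; apply: TensorRel0.
by move=> c x y /asboolP rx /asboolP ry; apply/asboolP; apply: TensorRelP.
Qed.

Definition tensor_submod := Submodule tensor_closed.
End TensorProduct.

Definition tensor (F : fieldType) (A B : lmodType F) : Type :=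
  vquot (tensor_submod A B).

HB.instance Definition _ (F : fieldType) (A B : lmodType F) :=
  GRing.Lmodule.copy (tensor A B) (vquot (tensor_submod A B)).

HB.lock Definition tens (F : fieldType) (A B : lmodType F) (a : A) (b : B) :
  tensor A B := vproj (tensor_submod A B) << (a, b) >>.

Notation "A ⊗ B" := (tensor A B) (at level 40, left associativity).
Notation "a \ox b" := (tens a b) (at level 40, left associativity).

Definition bilinear_fun (F : fieldType) (A B W : lmodType F)
    (f : A -> B -> W) : Prop :=
  (forall b, linear (f^~ b)) /\ (forall a, linear (f a)).

Section TensorTheory.
Variables (F : fieldType) (A B : lmodType F).
Local Notation free := {malg F[(A * B)%type]}.

Lemma tens_eq (x y : free) :
  tensor_rel (x - y) -> vproj (tensor_submod A B) x = vproj _ y.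
Proof. by move=> rxy; apply/eqP; rewrite vproj_eq; apply/asboolP. Qed.

Lemma tens_bilinear : bilinear_fun (@tens F A B).
Proof.
split=> [b c a a'|a c b b']; rewrite tens.unlock.
- rewrite (tens_eq (TensorRelDl _ _ _)) linearD /=; congr (_ + _).
  by rewrite (tens_eq (TensorRelZl _ _ _)) linearZ.
- rewrite (tens_eq (TensorRelDr _ _ _)) linearD /=; congr (_ + _).
  by rewrite (tens_eq (TensorRelZr _ _ _)) linearZ.
Qed.

Lemma tensZl c (a : A) (b : B) : (c *: a) \ox b = c *: (a \ox b).
Proof. by rewrite tens.unlock (tens_eq (TensorRelZl _ _ _)) linearZ. Qed.

Lemma tensZr c (a : A) (b : B) : a \ox (c *: b) = c *: (a \ox b).
Proof. by rewrite tens.unlock (tens_eq (TensorRelZr _ _ _)) linearZ. Qed.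

Lemma tensDl (a a' : A) (b : B) : (a + a') \ox b = a \ox b + a' \ox b.
Proof. by rewrite tens.unlock (tens_eq (TensorRelDl _ _ _)) linearD. Qed.

Lemma tensDr (a : A) (b b' : B) : a \ox (b + b') = a \ox b + a \ox b'.
Proof. by rewrite tens.unlock (tens_eq (TensorRelDr _ _ _)) linearD. Qed.

Lemma tensor_ind (P : A ⊗ B -> Prop) :
    (forall a b, P (a \ox b)) -> (forall s t, P s -> P t -> P (s + t)) ->
  forall t, P t.
Proof.
move=> Ptens PD t; rewrite -[t](@vreprK F _ (tensor_submod A B)).
move: (vrepr _) => x; rewrite [x]monalgE linear_sum /=.
elim/big_rec: _ => [|[a b] y _ IH]; first by rewrite -(scale0r (0 \ox 0))
  -tensZl.
apply: PD => //=.
have -> : << x@_(a, b) *g (a, b) >> = x@_(a, b) *: << (a, b) >> :> free.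
  by apply/malgP => k; rewrite mcoeffZ !mcoeffU mulr_natr.
have := Ptens (x@_(a, b) *: a) b.
by rewrite tensZl tens.unlock -linearZ_LR.
Qed.

Section Lift.
Variables (W : lmodType F) (f : A -> B -> W).

Definition free_lift (x : free) : W := \sum_(k <- msupp x) x@_k *: f k.1 k.2.

Lemma free_liftE (D : {fset (A * B)%type}) (x : free) : (msupp x `<=` D)%fset ->
  free_lift x = \sum_(k <- D) x@_k *: f k.1 k.2.
Proof.
move=> xD; rewrite /free_lift (big_fset_incl _ xD) // => k _ /mcoeff_outdom ->.
by rewrite scale0r.
Qed.

Lemma free_lift_linear : linear free_lift.
Proof.
move=> c x y; pose D := (msupp (c *: x + y) `|` (msupp x `|` msupp y))%fset.
have D1 : (msupp (c *: x + y) `<=` D)%fset by apply: fsubsetUl.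
have D2 : (msupp x `<=` D)%fset.
  exact: fsubset_trans (fsubsetUl _ _) (fsubsetUr _ _).
have D3 : (msupp y `<=` D)%fset.
  exact: fsubset_trans (fsubsetUr _ _) (fsubsetUr _ _).
rewrite (free_liftE D1) (free_liftE D2) (free_liftE D3).
rewrite scaler_sumr -big_split; apply: eq_bigr => k _ /=.
by rewrite mcoeffD mcoeffZ scalerDl scalerA.
Qed.

HB.instance Definition _ :=
  GRing.isLinear.Build F free W _ free_lift free_lift_linear.

Lemma free_liftU a b : free_lift << (a, b) >> = f a b.
Proof.
by rewrite (free_liftE msuppU_le) big_seq_fset1 mcoeffUU scale1r.
Qed.

Hypothesis fP : bilinear_fun f.

Lemma free_lift_rel x : x \in tensor_submod A B -> free_lift x = 0.
Proof.
have [fl fr] := fP; move=> /asboolP; elim=> {x}.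
- by rewrite linear0.
- by move=> c x y _ fx _ fy; rewrite linearP /= fx fy scaler0 addr0.
- move=> a a' b; rewrite linearB linearD /= !free_liftU.
  by have := fl b 1 a a'; rewrite !scale1r => ->; rewrite subrr.
- move=> a b b'; rewrite linearB linearD /= !free_liftU.
  by have := fr a 1 b b'; rewrite !scale1r => ->; rewrite subrr.
- move=> c a b; rewrite linearB linearZ /= !free_liftU.
  have f0 : f 0 b = 0.
    by apply/(addIr (f 0 b)); rewrite add0r -[in RHS](addr0 0) -{3}(scale1r 0)
      fl scale1r.
  by have := fl b c a 0; rewrite !addr0 f0 addr0 => ->; rewrite subrr.
- move=> c a b; rewrite linearB linearZ /= !free_liftU.
  have f0 : f a 0 = 0.
    by apply/(addIr (f a 0)); rewrite add0r -[in RHS](addr0 0) -{3}(scale1r 0)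
      fr scale1r.
  by have := fr a c b 0; rewrite !addr0 f0 addr0 => ->; rewrite subrr.
Qed.
End Lift.

End TensorTheory.

HB.lock Definition tensor_lift (F : fieldType) (A B W : lmodType F)
  (f : A -> B -> W) (fP : bilinear_fun f) (t : A ⊗ B) : W :=
  free_lift f (vrepr t).

Section TensorLift.
Variables (F : fieldType) (A B W : lmodType F) (f : A -> B -> W).
Hypothesis fP : bilinear_fun f.

Lemma tensor_lift_linear : linear (tensor_lift fP).
Proof.
by rewrite tensor_lift.unlock; exact: vlift_linear (free_lift_rel fP).
Qed.

HB.instance Definition _ :=
  GRing.isLinear.Build F (A ⊗ B) W _ (tensor_lift fP) tensor_lift_linear.

Lemma tensor_liftE a b : tensor_lift fP (a \ox b) = f a b.
Proof.
rewrite tensor_lift.unlock tens.unlock (vlift_proj (free_lift_rel fP)).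
exact: free_liftU.
Qed.

Lemma tensor_liftD s t :
  tensor_lift fP (s + t) = tensor_lift fP s + tensor_lift fP t.
Proof. exact: linearD. Qed.

Lemma tensor_liftZ c t : tensor_lift fP (c *: t) = c *: tensor_lift fP t.
Proof. exact: linearZ. Qed.
End TensorLift.

Section TensorMap.
Variables (F : fieldType) (A A' B B' : lmodType F).
Variables (f : {linear A -> A'}) (g : {linear B -> B'}).

Lemma tensor_map_bilinear : bilinear_fun (fun a b => f a \ox g b).
Proof.
by split=> [b c a a'|a c b b']; rewrite linearP ?tensDl ?tensDr ?tensZl ?tensZr.
Qed.

Definition tensor_map : {linear A ⊗ B -> A' ⊗ B'} :=
  tensor_lift tensor_map_bilinear.

Lemma tensor_mapE a b : tensor_map (a \ox b) = f a \ox g b.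
Proof. by rewrite /tensor_map /= tensor_liftE. Qed.
End TensorMap.

Section TensorAssoc.
Variables (F : fieldType) (A B C : lmodType F).

Lemma tensor_assoc_bilinear1 c :
  bilinear_fun (fun (a : A) (b : B) => a \ox (b \ox c : B ⊗ C)).
Proof.
by split=> [b k a a'|a k b b']; rewrite ?tensDl ?tensDr ?tensZl ?tensZr.
Qed.

Lemma tensor_assoc_bilinear :
  bilinear_fun (fun (t : A ⊗ B) (c : C) =>
    tensor_lift (tensor_assoc_bilinear1 c) t).
Proof.
split=> [c k s t|t k c c']; first by rewrite linearP.
elim/tensor_ind: t => [a b|s t IHs IHt].
  by rewrite !tensor_liftE !tensDr !tensZr.
by rewrite !tensor_liftD IHs IHt scalerDr addrACA.
Qed.

Definition tensor_assoc : {linear A ⊗ B ⊗ C -> A ⊗ (B ⊗ C)} :=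
  tensor_lift tensor_assoc_bilinear.

Lemma tensor_assocE a b c : tensor_assoc (a \ox b \ox c) = a \ox (b \ox c).
Proof. by rewrite /tensor_assoc /= !tensor_liftE. Qed.
End TensorAssoc.

Section TensorAlgebra.
Variables (F : fieldType) (A B : pzAlgType F).

Lemma tensor_mul_bilinear1 (a : A) (b : B) :
  bilinear_fun (fun (a' : A) (b' : B) => (a * a') \ox (b * b')).
Proof.
split=> [b' k x y|a' k x y]; rewrite mulrDr.
  by rewrite tensDl -tensZl; congr (_ \ox _ + _); apply: amulZr.
by rewrite tensDr -tensZr; congr (_ \ox _ + _); apply: amulZr.
Qed.

Lemma tensor_mul_bilinear (t : A ⊗ B) :
  bilinear_fun (fun (a : A) (b : B) =>
    tensor_lift (tensor_mul_bilinear1 a b) t).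
Proof.
split=> [b k a a'|a k b b']; elim/tensor_ind: t => [x y|s t IHs IHt].
- rewrite !tensor_liftE mulrDl tensDl -tensZl.
  by congr (_ \ox _ + _); apply: amulZl.
- by rewrite !tensor_liftD IHs IHt scalerDr addrACA.
- rewrite !tensor_liftE mulrDl tensDr -tensZr.
  by congr (_ \ox _ + _); apply: amulZl.
- by rewrite !tensor_liftD IHs IHt scalerDr addrACA.
Qed.

(* Determined by (a \ox b) (a' \ox b') = (a a') \ox (b b'), see tensor_mulE. *)
Definition tensor_mul (s t : A ⊗ B) : A ⊗ B :=
  tensor_lift (tensor_mul_bilinear t) s.

Lemma tensor_mulE a b a' b' :
  tensor_mul (a \ox b) (a' \ox b') = (a * a') \ox (b * b').
Proof. by rewrite /tensor_mul !tensor_liftE. Qed.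

Lemma tensor_mulDl : left_distributive tensor_mul +%R.
Proof. by move=> s t u; rewrite /tensor_mul tensor_liftD. Qed.

Lemma tensor_mulZl (k : F) s t :
  tensor_mul (k *: s) t = k *: tensor_mul s t.
Proof. by rewrite /tensor_mul tensor_liftZ. Qed.

Lemma tensor_mulDr : right_distributive tensor_mul +%R.
Proof.
move=> s t u; elim/tensor_ind: s => [a b|s s' IH IH'].
  by rewrite /tensor_mul !tensor_liftE tensor_liftD.
by rewrite !tensor_mulDl IH IH' addrACA.
Qed.

Lemma tensor_mulZr (k : F) s t :
  tensor_mul s (k *: t) = k *: tensor_mul s t.
Proof.
elim/tensor_ind: s => [a b|s s' IH IH'].
  by rewrite /tensor_mul !tensor_liftE tensor_liftZ.
by rewrite !tensor_mulDl IH IH' scalerDr.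
Qed.

Lemma tensor_mulA : associative tensor_mul.
Proof.
move=> s t u.
elim/tensor_ind: s => [a b|? ? IH IH']; last by rewrite !tensor_mulDl IH IH'.
elim/tensor_ind: t => [a' b'|? ? IH IH'].
  elim/tensor_ind: u => [a'' b''|? ? IH IH'];
    first by rewrite !tensor_mulE !mulrA.
  by rewrite !tensor_mulDr IH IH'.
by rewrite tensor_mulDl !tensor_mulDr tensor_mulDl IH IH'.
Qed.

Definition tensor_one : A ⊗ B := (1 : A) \ox (1 : B).

Lemma tensor_mul1l : left_id tensor_one tensor_mul.
Proof.
move=> t; elim/tensor_ind: t => [a b|? ? IH IH'].
  by rewrite tensor_mulE !mul1r.
by rewrite tensor_mulDr IH IH'.
Qed.

Lemma tensor_mul1r : right_id tensor_one tensor_mul.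
Proof.
move=> t; elim/tensor_ind: t => [a b|? ? IH IH'].
  by rewrite tensor_mulE !mulr1.
by rewrite tensor_mulDl IH IH'.
Qed.

HB.instance Definition _ := Lmodule_isPzAlgebra.Build F (A ⊗ B)
  tensor_mulA tensor_mul1l tensor_mul1r tensor_mulDl tensor_mulDr
  tensor_mulZl tensor_mulZr.

Lemma mul_bilinear : bilinear_fun (fun a b : A => a * b).
Proof.
split=> [b k a a'|a k b b'].
  by rewrite mulrDl; congr (_ + _); apply: amulZl.
by rewrite mulrDr; congr (_ + _); apply: amulZr.
Qed.

Definition mul_map : {linear A ⊗ A -> A} := tensor_lift mul_bilinear.
End TensorAlgebra.

(* The identifications F ⊗ H = H = H ⊗ F are written out in the counit axioms:
   h in H corresponds to 1 \ox h, respectively to h \ox 1. *)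
Record hopfAlg (F : fieldType) := HopfAlg {
  hopf_alg :> pzAlgType F;
  comul : alghom hopf_alg (hopf_alg ⊗ hopf_alg);
  counit : alghom hopf_alg F^o;
  antipode : {linear hopf_alg -> hopf_alg};
  comulA : forall h,
    tensor_assoc hopf_alg hopf_alg hopf_alg (tensor_map comul idfun (comul h))
    = tensor_map idfun comul (comul h);
  counitl : forall h, tensor_map counit idfun (comul h) = (1 : F^o) \ox h;
  counitr : forall h, tensor_map idfun counit (comul h) = h \ox (1 : F^o);
  antipodel : forall h,
    mul_map hopf_alg (tensor_map antipode idfun (comul h))
    = (counit h : F) *: (1 : hopf_alg);
  antipoder : forall h,
    mul_map hopf_alg (tensor_map idfun antipode (comul h))
    = (counit h : F) *: (1 : hopf_alg);
  antipode_bij : bijective antipode }.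

Section Bundle.
Variables (F : fieldType) (H : hopfAlg F).

Record right_coaction (P : pzAlgType F) (DeltaP : alghom P (P ⊗ H)) : Prop := {
  coactionA : forall p,
    tensor_assoc P H H (tensor_map DeltaP idfun (DeltaP p))
    = tensor_map idfun (comul H) (DeltaP p);
  coaction_counit : forall p,
    tensor_map idfun (counit H) (DeltaP p) = p \ox (1 : F^o) }.

(* (f ⊗ id) o DeltaP = (id ⊗ Delta) o f *)
Definition colinear (P B : pzAlgType F) (DeltaP : alghom P (P ⊗ H))
    (f : alghom P (B ⊗ H)) : Prop :=
  forall p, tensor_assoc B H H (tensor_map f idfun (DeltaP p))
            = tensor_map idfun (comul H) (f p).

Record locally_trivial_QPFB (B P : pzAlgType F) (DeltaP : alghom P (P ⊗ H))
    (iota : alghom B P) (I : finType) (J : I -> ideal B)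
    (chi : forall i, alghom P (quot (J i) ⊗ H)) : Prop := {
  qpfb_coaction : right_coaction DeltaP;
  qpfb_covering : complete_covering J;
  qpfb_chi_surj : forall i y, exists p, chi i p = y;
  qpfb_iota_inj : injective iota;
  qpfb_chi_colinear : forall i, colinear DeltaP (chi i);
  qpfb_chi_iota : forall i a, chi i (iota a) = proj (J i) a \ox (1 : H);
  qpfb_ker_covering : complete_covering (fun i => ker_ideal (chi i));
  qpfb_coinv : forall p, DeltaP p = p \ox (1 : H) <-> exists a, iota a = p }.
End Bundle.

(* Main.v *)
(* Put K_i = ker chi_i. As chi_i is surjective and colinear, P / (K_i + K_j) is
   the quotient of B_i ⊗ H by the ideal N = chi_i (K_j), which is stable under
   the coaction. By the antipode axiom such an ideal is of the form L ⊗ H with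
   L = {b | b \ox 1 \in N}, and what has to be shown is L = (J_i + J_j) / J_i.
   Clearly L contains pi_i (J_j). Conversely, let b \ox 1 = chi_i (p) with p in
   K_j. The element p is coinvariant in the charts i and j. Going through the
   remaining charts one at a time, p can be corrected by elements of the common
   kernel of the charts already treated so as to become coinvariant in all of
   them, again because chi_n of such a kernel has the form L' ⊗ H. Then
   p = iota (a) with pi_i (a) = b and pi_j (a) = 0, so that b lies in
   pi_i (J_j). *)
From HB Require Import structures.
Require Import Defs.
From mathcomp Require Import all_boot all_order all_algebra.
From mathcomp Require Import boolp classical_sets reals complex.

Set Implicit Arguments.
Unset Strict Implicit.
Unset Printing Implicit Defensive.

Import GRing.Theory.
Local Open Scope ring_scope.

Definition linear_of (F : fieldType) (V W : lmodType F) (f : V -> W)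
    (lin_f : linear f) : {linear V -> W} :=
  HB.pack f (GRing.isLinear.Build F V W _ f lin_f).

(** * Complements and generalized inverses in vector spaces *)

Section LinearAlgebra.
Variable F : fieldType.

(** A maximal set closed under linear combinations and meeting [N] at most in 0, given by Zorn's
    lemma, is a complement of [N]; [r] projects onto [N] along it. *)
Lemma linear_retraction (V : lmodType F) (N : submodule V) :
  exists r : {linear V -> V}, (forall v, r v \in N) /\ {in N, forall v, r v = v}.
Proof.
pose P (A : set V) :=
  (forall c x y, A x -> A y -> A (c *: x + y)) /\
  forall x, A x -> x \in N -> x = 0.
have [|C [[Clin CN] Cmax]] := @Zorn_bigcup V P.
  move=> S SP Stot; split=> [c x y [X SX Xx] [Y SY Yy]|x [X SX Xx]].
    have [XY|YX] := Stot _ _ SX SY.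
      by exists Y => //; apply: (SP _ SY).1 => //; apply: XY.
    by exists X => //; apply: (SP _ SX).1 => //; apply: YX.
  exact: (SP _ SX).2.
have [N0 Nlin] := submod_closedP N.
(* [P] admits the empty set, the union of the empty chain, so 0 in [C] has to come from
   maximality. *)
have C0 : C 0.
  apply: contrapT => nC0; apply: (Cmax (fun x => C x \/ x = 0)); split.
  - by move=> x; left.
  - by move=> /(_ 0 (or_intror erefl)).
  - move=> c x y [Cx|->] [Cy|->]; rewrite ?scaler0 ?add0r ?addr0; try by tauto.
      by left; apply: Clin.
    left; have : C (-1 *: x + x) by apply: Clin.
    by rewrite scaleN1r addNr => /nC0.
  - by move=> x [/CN//|->].
have CZ c x : C x -> C (c *: x) by move=> Cx; rewrite -[_ *: _]addr0; apply: Clin.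
have CD x y : C x -> C y -> C (x + y) by rewrite -{2}[x]scale1r; apply: Clin.
have NZ c x : x \in N -> c *: x \in N by exact: submodZ.
(* Otherwise the span of [v] and [C] is a larger set satisfying [P]: an element [c *: v + y] of [N]
   with [c] nonzero would yield a decomposition of [v]. *)
have sumNC v : exists n, n \in N /\ C (v - n).
  apply: contrapT => nv.
  apply: (Cmax (fun x => exists c y, C y /\ x = c *: v + y)).
    split.
    - by move=> x Cx; exists 0, x; rewrite scale0r add0r.
    - move=> /(_ v) vC; apply: nv; exists 0; split=> //; rewrite subr0; apply: vC.
      by exists 1, 0; rewrite scale1r addr0.
  split=> [c _ _ [a [x [Cx ->]]] [b [y [Cy ->]]]|_ [c [y [Cy ->]]] yN].
    exists (c * a + b), (c *: x + y); split; first exact: Clin.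
    by rewrite scalerDr scalerDl scalerA addrACA.
  have [c0|c0] := eqVneq c 0.
    by move: yN; rewrite c0 scale0r add0r => /(CN _ Cy).
  exfalso; apply: nv; exists (c^-1 *: (c *: v + y)); split; first exact: NZ.
  rewrite scalerDr scalerA mulVf // scale1r opprD addNKr -scaleNr.
  exact: CZ.
have [r rP] := choice sumNC.
have r_uniq v n : n \in N -> C (v - n) -> n = r v.
  move=> nN Cn; have [rN Cr] := rP v; apply/eqP; rewrite -subr_eq0; apply/eqP.
  apply: CN.
    have -> : n - r v = (v - r v) + (-1) *: (v - n).
      by rewrite scaleN1r opprB [RHS]addrC addrA subrK.
    by apply: CD => //; apply: CZ.
  rewrite addrC -scaleN1r; exact: Nlin.
have lin_r : linear r.
  move=> c x y; apply/esym/r_uniq.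
    by apply: Nlin; case: (rP x) (rP y) => ? _ [].
  have -> : c *: x + y - (c *: r x + r y) = c *: (x - r x) + (y - r y).
    by rewrite opprD addrACA scalerBr.
  by apply: Clin; case: (rP x) (rP y) => _ ? [].
exists (linear_of lin_r); split=> [v|v vN] /=; first by case: (rP v).
by apply/esym/r_uniq => //; rewrite subrr.
Qed.

(** Preimages [t w] of the projection [e w] of [w] onto the image are chosen arbitrarily; removing
    their component in the kernel makes the choice linear. *)
Lemma linear_generalized_inverse (V W : lmodType F) (f : {linear V -> W}) :
  exists s : {linear W -> V}, forall v, f (s (f v)) = f v.
Proof.
have ker_closed : submod_closed (fun v => f v == 0).
  split=> [|c x y /eqP fx /eqP fy]; apply/eqP; first by rewrite linear0.
  by rewrite linearP fx fy scaler0 addr0.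
have im_closed : submod_closed (fun w => `[< exists v, f v = w >]).
  split=> [|c _ _ /asboolP[x <-] /asboolP[y <-]]; apply/asboolP.
    by exists 0; rewrite linear0.
  by exists (c *: x + y); rewrite linearP.
have [k [kN kid]] := linear_retraction (Submodule ker_closed).
have [e [eN eid]] := linear_retraction (Submodule im_closed).
have [t tP] := choice (fun w => asboolW (eN w)).
have lin_s : linear (fun w => t w - k (t w)).
  move=> c x y; set u := t (c *: x + y).
  have kE : k (u - (c *: t x + t y)) = u - (c *: t x + t y).
    by apply/kid/eqP; rewrite linearB linearP !tP linearP subrr.
  rewrite linearB linearP /= in kE.
  rewrite scalerBr addrACA -opprD; apply/eqP.
  by rewrite -subr_eq0 [X in _ + X]opprD addrACA -opprD -kE subrr.
exists (linear_of lin_s) => v /=; rewrite linearB tP.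
have /eqP -> : f (k (t (f v))) == 0 by have := kN (t (f v)).
by rewrite subr0; apply: eid; apply/asboolP; exists v.
Qed.

End LinearAlgebra.

(** * Tensor products of linear maps, associativity and exactness *)

Section Tensors.
Variable F : fieldType.
Implicit Types A B C : lmodType F.

(** The composites [f''] and [g''] only have to agree pointwise, so any linear structure on them is
    accepted. *)
Lemma tensor_map_comp A A' A'' B B' B''
    (f : {linear A' -> A''}) (g : {linear B' -> B''})
    (f' : {linear A -> A'}) (g' : {linear B -> B'})
    (f'' : {linear A -> A''}) (g'' : {linear B -> B''}) t :
    (forall a, f (f' a) = f'' a) -> (forall b, g (g' b) = g'' b) ->
  tensor_map f g (tensor_map f' g' t) = tensor_map f'' g'' t.
Proof.
move=> ff gg; elim/tensor_ind: t => [a b|s t IHs IHt].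
  by rewrite !tensor_mapE ff gg.
by rewrite !linearD IHs IHt.
Qed.

Lemma tensor_map_id A B (f : {linear A -> A}) (g : {linear B -> B}) t :
  f =1 id -> g =1 id -> tensor_map f g t = t.
Proof.
move=> fid gid; elim/tensor_ind: t => [a b|s t IHs IHt].
  by rewrite tensor_mapE fid gid.
by rewrite linearD IHs IHt.
Qed.

Lemma tensor_assoc_map A A' B B' C C' (f : {linear A -> A'})
    (g : {linear B -> B'}) (h : {linear C -> C'}) t :
  tensor_assoc A' B' C' (tensor_map (tensor_map f g) h t)
  = tensor_map f (tensor_map g h) (tensor_assoc A B C t).
Proof.
elim/tensor_ind: t => [s c|? ? IHs IHt]; last by rewrite !linearD IHs IHt.
elim/tensor_ind: s => [a b|s t IHs IHt].
  by rewrite !(tensor_mapE, tensor_assocE).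
by rewrite tensDl !linearD IHs IHt.
Qed.

Lemma tens0l A B (b : B) : (0 : A) \ox b = 0.
Proof. by rewrite -(scale0r 0) tensZl scale0r. Qed.

Lemma tensBl A B (a a' : A) (b : B) : (a - a') \ox b = a \ox b - a' \ox b.
Proof. by rewrite tensDl -scaleN1r tensZl scaleN1r. Qed.

Section AssociatorInverse.
Variables A B C : lmodType F.

Lemma tensor_assocV_bilinear1 a :
  bilinear_fun (fun (b : B) (c : C) => ((a : A) \ox b) \ox c).
Proof.
by split=> [c k b b'|b k c c']; rewrite ?tensDr ?tensZr ?tensDl ?tensZl.
Qed.

Lemma tensor_assocV_bilinear :
  bilinear_fun (fun (a : A) (t : B ⊗ C) =>
    tensor_lift (tensor_assocV_bilinear1 a) t).
Proof.
split=> [t k a a'|a k s t]; last by rewrite linearP.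
elim/tensor_ind: t => [b c|s t IHs IHt].
  by rewrite !tensor_liftE !tensDl !tensZl.
by rewrite !tensor_liftD IHs IHt scalerDr addrACA.
Qed.

Lemma tensor_assoc_inj : injective (tensor_assoc A B C).
Proof.
apply: (can_inj (g := tensor_lift tensor_assocV_bilinear)).
elim/tensor_ind=> [s c|s t IHs IHt]; last by rewrite linearD tensor_liftD IHs IHt.
elim/tensor_ind: s => [a b|s t IHs IHt].
  by rewrite tensor_assocE !tensor_liftE.
by rewrite tensDl linearD tensor_liftD IHs IHt.
Qed.
End AssociatorInverse.

(* The subspace K ⊗ B of A ⊗ B. *)
Inductive left_in A B (K : A -> Prop) : A ⊗ B -> Prop :=
| LeftInTens a b : K a -> left_in K (a \ox b)
| LeftInD s t : left_in K s -> left_in K t -> left_in K (s + t).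

Lemma left_in_map A A' B B' (K : A -> Prop) (K' : A' -> Prop)
    (f : {linear A -> A'}) (g : {linear B -> B'}) t :
  (forall a, K a -> K' (f a)) -> left_in K t -> left_in K' (tensor_map f g t).
Proof.
move=> fK; elim=> [a b Ka|s u _ IHs _ IHu].
  by rewrite tensor_mapE; apply/LeftInTens/fK.
by rewrite linearD; apply: LeftInD.
Qed.

Lemma left_in_eq0 A A' B B' (K : A -> Prop)
    (f : {linear A -> A'}) (g : {linear B -> B'}) t :
  (forall a, K a -> f a = 0) -> left_in K t -> tensor_map f g t = 0.
Proof.
move=> fK; elim=> [a b Ka|s u _ IHs _ IHu].
  by rewrite tensor_mapE fK ?tens0l.
by rewrite linearD IHs IHu addr0.
Qed.

(* Tensor products over a field are exact: the joint kernel of the f i ⊗ id is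
   that of the f i, tensored with B. *)
Lemma joint_kernel_retraction A B (I : eqType) (W : I -> lmodType F)
    (f : forall i, {linear A -> W i}) (s : seq I) :
  exists r : {linear A -> A},
    (forall a i, i \in s -> f i (r a) = 0) /\
    forall z : A ⊗ B, (forall i, i \in s -> tensor_map (f i) idfun z = 0) ->
      tensor_map r idfun z = z.
Proof.
elim: s => [|n s [r [rK rE]]].
  by exists idfun; split=> // z _; apply: tensor_map_id.
(* Since [f n \o r] is unchanged by first applying [t \o (f n \o r)], subtracting
   [r \o t \o f n \o r] from [r] makes [f n] vanish as well; on tensors killed by all the maps the
   correction is zero. *)
have [t ft] := linear_generalized_inverse (f n \o r).
exists (r \- ((r \o t) \o (f n \o r))); split=> [a i|z zK].
  rewrite inE /= linearB => /orP[/eqP->|si]; last by rewrite !rK ?subrr.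
  by have /= -> := ft a; rewrite subrr.
have rz : tensor_map r idfun z = z.
  by apply: rE => i si; apply: zK; rewrite inE si orbT.
have fz : tensor_map (f n \o r) idfun z = 0.
  rewrite -(zK n) ?mem_head // -[in RHS]rz.
  by apply/esym/tensor_map_comp.
rewrite -[RHS]rz -[RHS]subr0 -(linear0 (tensor_map (r \o t) idfun)) -fz.
elim/tensor_ind: z {zK rz fz} => [a b|x y IHx IHy].
  by rewrite !tensor_mapE /= tensBl.
by rewrite !linearD /= addrACA IHx IHy.
Qed.

Lemma joint_kernel_tensor A B (I : eqType) (W : I -> lmodType F)
    (f : forall i, {linear A -> W i}) (s : seq I) (z : A ⊗ B) :
  (forall i, i \in s -> tensor_map (f i) idfun z = 0) ->
  left_in (fun a => forall i, i \in s -> f i a = 0) z.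
Proof.
have [r [rK rE]] := joint_kernel_retraction B f s.
move=> /rE <-; elim/tensor_ind: z => [a b|x y IHx IHy].
  by rewrite tensor_mapE; apply: LeftInTens => i; apply: rK.
by rewrite linearD; apply: LeftInD.
Qed.

End Tensors.

(* PzAlgebra.sort carries the ring structure generically; these make it
   available on the concrete types as well. *)
HB.instance Definition _ (F : fieldType) (A B : pzAlgType F) :=
  GRing.PzRing.copy (A ⊗ B) (PzAlgebra.sort (A ⊗ B : pzAlgType F)).

HB.instance Definition _ (F : fieldType) (A : pzAlgType F) (J : ideal A) :=
  GRing.PzRing.copy (quot J) (PzAlgebra.sort (quot J : pzAlgType F)).

(** * Contractions by the counit and the antipode *)

Section HopfContraction.
Variables (F : fieldType) (H : hopfAlg F).
Implicit Types A : lmodType F.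

Lemma scale_bilinear_l A : bilinear_fun (fun (c : F^o) (a : A) => (c : F) *: a).
Proof.
split=> [a k c d|c k a b]; first by rewrite scalerDl scalerA.
by rewrite scalerDr !scalerA mulrC.
Qed.

Lemma scale_bilinear_r A : bilinear_fun (fun (a : A) (c : F^o) => (c : F) *: a).
Proof. by have [l r] := scale_bilinear_l A. Qed.

Definition contract_counitl A : {linear H ⊗ A -> A} :=
  tensor_lift (scale_bilinear_l A) \o tensor_map (counit H) idfun.

Definition contract_counit A : {linear A ⊗ H -> A} :=
  tensor_lift (scale_bilinear_r A) \o tensor_map idfun (counit H).

Lemma contract_counitE A (a : A) (h : H) :
  contract_counit A (a \ox h) = (counit H h : F) *: a.
Proof. by rewrite /= !tensor_liftE. Qed.

Lemma contract_counit1 A (a : A) : contract_counit A (a \ox (1 : H)) = a.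
Proof. by rewrite contract_counitE (alghomP (counit H)).1 scale1r. Qed.

Lemma contract_counitl_comul (h : H) : contract_counitl H (comul H h) = h.
Proof. have -> : contract_counitl H (comul H h)
  = tensor_lift (scale_bilinear_l H) (tensor_map (counit H) idfun (comul H h)) by [].
by rewrite counitl tensor_liftE scale1r. Qed.

Lemma contract_comul A (y : A ⊗ H) :
  tensor_map idfun (contract_counitl H) (tensor_map idfun (comul H) y) = y.
Proof.
rewrite (tensor_map_comp (f'' := idfun) (g'' := idfun)) ?tensor_map_id // => h.
exact: contract_counitl_comul.
Qed.

(** Both sides apply the counit to the middle factor. *)
Lemma contract_assoc A (z : A ⊗ H ⊗ H) :
  tensor_map idfun (contract_counitl H) (tensor_assoc A H H z)
  = tensor_map (contract_counit A) idfun z.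
Proof.
elim/tensor_ind: z => [t h|s t IHs IHt]; last by rewrite !linearD IHs IHt.
elim/tensor_ind: t => [a k|s t IHs IHt].
  rewrite tensor_assocE !tensor_mapE contract_counitE /= !tensor_liftE.
  by rewrite tensZl tensZr.
by rewrite tensDl !linearD IHs IHt.
Qed.

Definition contract_antipode : {linear H ⊗ H -> H} :=
  mul_map H \o tensor_map idfun (antipode H).

Lemma contract_antipode_comul A (y : A ⊗ H) :
  tensor_map idfun contract_antipode (tensor_map idfun (comul H) y)
  = contract_counit A y \ox (1 : H).
Proof.
elim/tensor_ind: y => [a h|s t IHs IHt].
  by rewrite !tensor_mapE contract_counitE tensZl -tensZr -antipoder.
by rewrite !linearD tensDl IHs IHt.
Qed.

(** Being a right multiplication, this contraction sends [y \ox h] into any right ideal containing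
    [y]. *)
Lemma contract_antipode_assoc (A : pzAlgType F) (y : A ⊗ H) (h : H) :
  tensor_map idfun contract_antipode (tensor_assoc A H H (y \ox h))
  = y * ((1 : A) \ox antipode H h).
Proof.
elim/tensor_ind: y => [a k|s t IHs IHt].
  rewrite tensor_assocE tensor_mapE /= !tensor_liftE /=.
  by rewrite [RHS]tensor_mulE mulr1.
by rewrite tensDl !linearD IHs IHt mulrDl.
Qed.

End HopfContraction.

(** * Images of kernels under the charts, and chartwise coinvariance *)

Section Coinvariants.
Variables (F : fieldType) (H : hopfAlg F) (P : pzAlgType F).
Variables (DeltaP : alghom P (P ⊗ H)) (I : finType) (B : I -> pzAlgType F).
Variable chi : forall i, alghom P (B i ⊗ H).
Hypothesis chi_surj : forall i y, exists p, chi i p = y.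
Hypothesis chi_colinear : forall i, colinear DeltaP (chi i).
Implicit Types s : seq I.

Local Notation ev := (contract_counit H _).

(* The ideal chi_n (\bigcap_(i in s) ker chi_i) of B_n ⊗ H. *)
Definition chi_image_kers (n : I) (s : seq I) (y : B n ⊗ H) : Prop :=
  exists2 p, forall i, i \in s -> chi i p = 0 & chi n p = y.

Lemma chi_image_kersD n s y z :
  chi_image_kers s y -> chi_image_kers s z -> chi_image_kers (n := n) s (y + z).
Proof.
move=> [p pK <-] [q qK <-]; exists (p + q); last by rewrite linearD.
by move=> i si; rewrite linearD pK ?qK ?addr0.
Qed.

Lemma chi_image_kersMr n s y z :
  chi_image_kers s y -> chi_image_kers (n := n) s (y * z).
Proof.
move=> [p pK <-]; have [q <-] := chi_surj z; exists (p * q).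
  by move=> i si; rewrite (alghomP (chi i)).2 pK ?mul0r.
by rewrite (alghomP (chi n)).2.
Qed.

(** By exactness, [z] already lies in the common kernel tensored with [H]. *)
Lemma left_in_chi_image_kers n s (z : P ⊗ H) :
  (forall i, i \in s -> tensor_map (chi i) idfun z = 0) ->
  left_in (chi_image_kers (n := n) s) (tensor_map (chi n) idfun z).
Proof.
move=> /(joint_kernel_tensor (f := fun i => alghom_fun (chi i))).
by apply: left_in_map => p pK; exists p.
Qed.

Lemma tensor_chi_coaction_inj i p t :
  tensor_map idfun (comul H) (chi i p) = tensor_assoc (B i) H H t ->
  tensor_map (chi i) idfun (DeltaP p) = t.
Proof. by rewrite -chi_colinear => /tensor_assoc_inj. Qed.

(** Write N for the ideal in question. The coaction maps y into N ⊗ H; contracting with the antipode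
    sends this back into N, while the antipode axiom evaluates the result to [ev y \ox 1]. *)
Lemma chi_image_kers_contract n s y :
  chi_image_kers s y -> chi_image_kers (n := n) s (ev y \ox (1 : H)).
Proof.
move=> [p pK <-].
have: left_in (chi_image_kers (n := n) s) (tensor_map (chi n) idfun (DeltaP p)).
  apply: left_in_chi_image_kers => i si; apply: tensor_chi_coaction_inj.
  by rewrite pK // !linear0.
rewrite -contract_antipode_comul -chi_colinear.
elim=> [{}y h yN|t u _ IHt _ IHu]; last first.
  by rewrite !linearD; apply: chi_image_kersD.
by rewrite contract_antipode_assoc; apply: chi_image_kersMr.
Qed.

Lemma chi_image_kers_contract_tensor n s z :
  left_in (chi_image_kers (n := n) s) z ->
  chi_image_kers s (tensor_map ev idfun z).
Proof.
elim=> [y h yN|t u _ IHt _ IHu]; last first.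
  by rewrite !linearD; apply: chi_image_kersD.
rewrite tensor_mapE;
have -> : ev y \ox h = (ev y \ox (1 : H)) * ((1 : B n) \ox h).
  by rewrite [RHS]tensor_mulE mulr1 mul1r.
by apply/chi_image_kersMr/chi_image_kers_contract.
Qed.

(** This says that [chi i p] has the form [b \ox 1]; by [contract_counit1] such a [b] can only be
    [ev (chi i p)]. *)
Definition chart_coinvariant p i := chi i p = ev (chi i p) \ox (1 : H).

Lemma chart_coinvariantP p i :
  chart_coinvariant p i ->
  tensor_map (chi i) idfun (DeltaP p - p \ox (1 : H)) = 0.
Proof.
move=> pi; rewrite linearB tensor_mapE; apply/eqP; rewrite subr_eq0; apply/eqP.
apply: tensor_chi_coaction_inj; rewrite pi tensor_mapE tensor_assocE /=.
by rewrite (alghomP (comul H)).1.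
Qed.

(* Writing K for the common kernel of the charts in s, the element p is
   coinvariant modulo K, so chi_n p differs from a coinvariant by an element of
   chi_n K; correcting p by a preimage in K leaves the charts in s unchanged. *)
Lemma chart_coinvariant_add p s n :
    (forall i, i \in s -> chart_coinvariant p i) ->
  exists2 q, forall i, i \in s -> chi i q = chi i p & chart_coinvariant q n.
Proof.
move=> ps; set y := chi n p.
have /chi_image_kers_contract_tensor : left_in (chi_image_kers (n := n) s)
    (tensor_map (chi n) idfun (DeltaP p - p \ox (1 : H))).
  by apply: left_in_chi_image_kers => i /ps/chart_coinvariantP.
(* The contracted element is [y - ev y \ox 1], so subtracting its preimage [k] from [p] leaves
   [ev y \ox 1] in chart [n]. *)
rewrite !linearB !tensor_mapE -contract_assoc chi_colinear contract_comul.
move=> [k ks kn]; exists (p - k) => [i si|]; first by rewrite linearB ks ?subr0.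
by rewrite /chart_coinvariant linearB kn opprB addrC subrK contract_counit1.
Qed.

Lemma chart_coinvariant_extend p s :
    (forall i, i \in s -> chart_coinvariant p i) ->
  exists2 q, forall i, i \in s -> chi i q = chi i p
           & forall i, chart_coinvariant q i.
Proof.
move=> ps.
have [q qs qt] : exists2 q, forall i, i \in s -> chi i q = chi i p
    & forall i, i \in enum I ++ s -> chart_coinvariant q i.
  (* Keeping [s] in the list of treated charts ensures that later corrections do not alter the
     values there. *)
  elim: (enum I) => [|n t [q qs qt]]; first by exists p.
  have [r rE rn] := chart_coinvariant_add n qt; exists r => [i si|i].
    by rewrite rE ?qs // mem_cat si orbT.
  rewrite inE => /orP[/eqP-> //|it].
  by rewrite /chart_coinvariant rE //; apply: qt.
by exists q => // i; apply: qt; rewrite mem_cat mem_enum.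
Qed.

Lemma left_in_coaction s p :
  (forall i, i \in s -> chi i p = 0) ->
  left_in (fun q => forall i, i \in s -> chi i q = 0) (DeltaP p).
Proof.
move=> ps; apply: (joint_kernel_tensor (f := fun i => alghom_fun (chi i))).
by move=> i si; apply: tensor_chi_coaction_inj; rewrite ps // !linear0.
Qed.

(** The difference of both sides lies in the common kernel of all charts tensored with [H], and that
    kernel is zero. *)
Lemma coinvariant_charts p :
    (forall q, (forall i, chi i q = 0) -> q = 0) ->
    (forall i, chart_coinvariant p i) ->
  DeltaP p = p \ox (1 : H).
Proof.
move=> cov pc; apply/eqP; rewrite -subr_eq0; apply/eqP.
set z := _ - _; rewrite -[z](tensor_map_id (f := idfun) (g := idfun)) //.
apply: (left_in_eq0 (K := fun q => forall i, i \in enum I -> chi i q = 0)).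
  by move=> q qK; apply: cov => i; apply: qK; rewrite mem_enum.
apply: (joint_kernel_tensor (f := fun i => alghom_fun (chi i))) => i _.
exact: chart_coinvariantP.
Qed.

(** Thus [chi i] is recovered from the coaction and the map [ev \o chi i] into the base. *)
Lemma contract_coaction i p :
  tensor_map ev idfun (tensor_map (chi i) idfun (DeltaP p)) = chi i p.
Proof. by rewrite -contract_assoc chi_colinear contract_comul. Qed.

End Coinvariants.

(** * Algebra homomorphisms: composites, tensor products, factorization through quotients *)

Section AlgebraHomomorphisms.
Variable F : fieldType.
Implicit Types A B C : pzAlgType F.

Lemma proj_morphism A (J : ideal A) :
  monoid_morphism (proj J : {linear A -> quot J}).
Proof. by split=> // x y; apply: projM. Qed.

Lemma proj_eq0 A (J : ideal A) x : (proj J x == 0) = (x \in J).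
Proof. by rewrite -(linear0 (proj J)) proj_eq subr0. Qed.

Definition proj_alghom A (J : ideal A) : alghom A (quot J) :=
  AlgHom (proj_morphism J).

Definition id_alghom A : alghom A A :=
  @AlgHom F A A idfun (conj erefl (fun x y => erefl)).

Lemma comp_morphism A B C (g : alghom B C) (f : alghom A B) :
  monoid_morphism (g \o f).
Proof.
split=> [|x y] /=; first by rewrite (alghomP f).1 (alghomP g).1.
by rewrite (alghomP f).2 (alghomP g).2.
Qed.

Definition comp_alghom A B C (g : alghom B C) (f : alghom A B) : alghom A C :=
  AlgHom (comp_morphism g f).

Lemma tensor_map_morphism A A' B B' (f : alghom A A') (g : alghom B B') :
  monoid_morphism (tensor_map f g).
Proof.
split=> [|s t].
  have -> : (1 : A ⊗ B) = (1 : A) \ox (1 : B) by [].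
  by rewrite tensor_mapE (alghomP f).1 (alghomP g).1.
elim/tensor_ind: s => [a b|s s' IH IH'].
  elim/tensor_ind: t => [a' b'|t t' IH IH'].
    have -> : (a \ox b) * (a' \ox b') = (a * a') \ox (b * b') :> A ⊗ B.
      exact: tensor_mulE.
    rewrite !tensor_mapE (alghomP f).2 (alghomP g).2.
    exact/esym/tensor_mulE.
  by rewrite mulrDr !linearD IH IH' mulrDr.
by rewrite mulrDl !linearD IH IH' mulrDl.
Qed.

Definition tensor_alghom A A' B B' (f : alghom A A') (g : alghom B B') :
  alghom (A ⊗ B) (A' ⊗ B') := AlgHom (tensor_map_morphism f g).

Section QuotientLift.
Variables (A B : pzAlgType F) (J : ideal A) (f : alghom A B).
Hypothesis fJ : forall x, x \in J -> f x = 0.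

Lemma quot_lift_proj x : f (quot_repr (proj J x)) = f x.
Proof. exact: vlift_proj. Qed.

Lemma quot_lift_linear : linear (fun q : quot J => f (quot_repr q)).
Proof. exact: (vlift_linear fJ). Qed.

Lemma quot_lift_morphism : monoid_morphism (linear_of quot_lift_linear).
Proof.
split=> [|p q]; first by rewrite -(alghomP f).1; apply: quot_lift_proj.
have [[x <-] [y <-]] := (proj_surj p, proj_surj q).
by rewrite -(proj_morphism J).2 /= !quot_lift_proj (alghomP f).2.
Qed.

Definition quot_lift : alghom (quot J) B := AlgHom quot_lift_morphism.

Lemma quot_liftE x : quot_lift (proj J x) = f x.
Proof. exact: quot_lift_proj. Qed.
End QuotientLift.
End AlgebraHomomorphisms.

(** * Trivialization, coaction and base inclusion on the overlap of two charts *)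

Section Proposition.
Variables (F : fieldType) (H : hopfAlg F) (B P : pzAlgType F).
Variables (DeltaP : alghom P (P ⊗ H)) (iota : alghom B P).
Variables (I : finType) (J : I -> ideal B).
Variable chi : forall i, alghom P (quot (J i) ⊗ H).
Hypothesis hP : locally_trivial_QPFB DeltaP iota chi.
Variables i j : I.

Local Notation K := (ideal_sum (ker_ideal (chi i)) (ker_ideal (chi j))).
Local Notation L := (ideal_sum (J i) (J j)).
Local Notation ev := (contract_counit H _).

Let chi_surj := qpfb_chi_surj hP.
Let chi_colinear := qpfb_chi_colinear hP.

(* The element ev (chi_i p) \ox 1 lies in chi_i (ker chi_j); a preimage of it in
   ker chi_j can be chosen coinvariant, that is, in the image of iota. *)
Lemma contract_chi_base p :
  chi j p = 0 -> exists2 a, a \in J j & proj (J i) a = ev (chi i p).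
Proof.
move=> pj.
have [k kj ki] : chi_image_kers chi [:: j] (ev (chi i p) \ox (1 : H)).
  apply: (chi_image_kers_contract chi_surj chi_colinear).
  by exists p => // l; rewrite inE => /eqP->.
have {}kj : chi j k = 0 by apply: kj; rewrite mem_head.
have [|q qk qc] :=
    chart_coinvariant_extend chi_surj chi_colinear (p := k) (s := [:: i; j]).
  move=> l; rewrite !inE /chart_coinvariant => /orP[]/eqP->.
    by rewrite ki contract_counit1.
  by rewrite kj linear0 tens0l.
have /(qpfb_coinv hP) [a aq] : DeltaP q = q \ox (1 : H).
  apply: (coinvariant_charts chi_colinear) => // r r0.
  by have [cov _] := qpfb_ker_covering hP; apply: cov => l; apply/eqP/r0.
have aE l : proj (J l) a = ev (chi l q).
  by rewrite -aq (qpfb_chi_iota hP) contract_counit1.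
exists a; last by rewrite aE qk ?ki ?mem_head // contract_counit1.
by rewrite -proj_eq0 aE qk ?kj ?linear0 // !inE eqxx orbT.
Qed.

Lemma left_in_coaction_ker l p :
  chi l p = 0 -> left_in (fun q => chi l q = 0) (DeltaP p).
Proof.
move=> pl; have :
  left_in (fun q => forall k, k \in [:: l] -> chi k q = 0) (DeltaP p).
  by apply: (left_in_coaction chi_colinear) => k; rewrite inE => /eqP->.
rewrite -{2}[DeltaP p](tensor_map_id (f := idfun) (g := idfun)) //.
by apply: left_in_map => a; apply; rewrite mem_head.
Qed.

Lemma base_restriction_vanish x : x \in J i -> proj_alghom L x = 0.
Proof. by move=> xJ; apply/eqP; rewrite proj_eq0; apply: ideal_suml. Qed.

Definition base_restriction : alghom (quot (J i)) (quot L) :=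
  quot_lift base_restriction_vanish.

Lemma base_restrictionE a : base_restriction (proj (J i) a) = proj L a.
Proof. exact: quot_liftE. Qed.

Definition chart_restriction : alghom P (quot L ⊗ H) :=
  comp_alghom (tensor_alghom base_restriction (id_alghom H)) (chi i).

Lemma chart_restrictionE p :
  chart_restriction p = tensor_map base_restriction idfun (chi i p).
Proof. by []. Qed.

(** For [y] in ker chi_j, the coaction stays in ker chi_j ⊗ H, and [ev \o chi i] maps ker chi_j into
    the image of J_j, which is zero in B_ij. *)
Lemma chart_restriction_vanish p : p \in K -> chart_restriction p = 0.
Proof.
move=> /asboolP[x [y [/eqP xi /eqP yj ->]]].
rewrite linearD !chart_restrictionE xi linear0 add0r.
rewrite -(contract_coaction chi_colinear).
pose f : {linear P -> quot L} := (base_restriction \o ev) \o chi i.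
transitivity (tensor_map f idfun (DeltaP y)).
  transitivity (tensor_map (base_restriction \o ev) idfun
                  (tensor_map (chi i) idfun (DeltaP y))).
    exact: tensor_map_comp.
  exact: tensor_map_comp.
apply: (left_in_eq0 _ _ (left_in_coaction_ker yj)) => p' p'j.
have [a aJ aE] := contract_chi_base p'j.
transitivity (base_restriction (ev (chi i p'))) => //.
rewrite -aE base_restrictionE; apply/eqP.
by rewrite proj_eq0; apply: ideal_sumr.
Qed.

Definition chi_ij : alghom (quot K) (quot L ⊗ H) :=
  quot_lift chart_restriction_vanish.

Lemma chi_ijE p :
  chi_ij (proj K p) = tensor_map base_restriction idfun (chi i p).
Proof. exact: quot_liftE. Qed.

Definition coaction_restriction : alghom P (quot K ⊗ H) :=
  comp_alghom (tensor_alghom (proj_alghom K) (id_alghom H)) DeltaP.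

(** Each kernel is a subcomodule by [left_in_coaction_ker], hence so is their sum. *)
Lemma coaction_restriction_vanish p : p \in K -> coaction_restriction p = 0.
Proof.
have vanish l x : {subset ker_ideal (chi l) <= K} -> chi l x = 0 ->
    tensor_map (proj_alghom K) idfun (DeltaP x) = 0.
  move=> lK xl; apply: (left_in_eq0 _ _ (left_in_coaction_ker xl)) => y yl.
  by apply/eqP; rewrite proj_eq0; apply/lK/eqP.
move=> /asboolP[x [y [/eqP xi /eqP yj ->]]].
rewrite linearD -[RHS]addr0; congr (_ + _).
  by apply: (vanish i) => //; apply: ideal_suml.
by apply: (vanish j) => //; apply: ideal_sumr.
Qed.

Definition coaction_ij : alghom (quot K) (quot K ⊗ H) :=
  quot_lift coaction_restriction_vanish.

Lemma coaction_ijE p :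
  coaction_ij (proj K p) = tensor_map (proj_alghom K) idfun (DeltaP p).
Proof. exact: quot_liftE. Qed.

Lemma iota_vanish a : a \in L -> comp_alghom (proj_alghom K) iota a = 0.
Proof.
have vanish l x : x \in J l -> iota x \in ker_ideal (chi l).
  rewrite -proj_eq0 => /eqP x0.
  by apply/eqP; rewrite (qpfb_chi_iota hP) x0 tens0l.
move=> /asboolP[x [y [/vanish xi /vanish yj ->]]]; apply/eqP.
by rewrite /= linearD proj_eq0; apply/asboolP; exists (iota x), (iota y).
Qed.

Definition iota_ij : alghom (quot L) (quot K) := quot_lift iota_vanish.

Lemma iota_ijE a : iota_ij (proj L a) = proj K (iota a).
Proof. exact: quot_liftE. Qed.

Lemma chi_ij_iota_ij a : chi_ij (iota_ij a) = a \ox (1 : H).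
Proof.
have [x <-] := proj_surj a.
by rewrite iota_ijE chi_ijE (qpfb_chi_iota hP) tensor_mapE base_restrictionE.
Qed.

(** The map [ev \o chi_ij] is a left inverse. *)
Lemma iota_ij_inj : injective iota_ij.
Proof.
move=> a b ab; rewrite -(contract_counit1 H a) -(contract_counit1 H b).
by rewrite -!chi_ij_iota_ij ab.
Qed.

Lemma coaction_ijP : right_coaction coaction_ij.
Proof.
have [coA counitP] := qpfb_coaction hP.
split=> p; have [x <-] := proj_surj p; rewrite !coaction_ijE.
  transitivity (tensor_map (proj_alghom K) (tensor_map idfun idfun)
                  (tensor_assoc P H H (tensor_map DeltaP idfun (DeltaP x)))).
    (* Both iterated coactions factor through [coaction_restriction] in the first leg. *)
    rewrite -tensor_assoc_map; congr (tensor_assoc _ _ _ _).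
    transitivity (tensor_map coaction_restriction idfun (DeltaP x)).
      by apply: tensor_map_comp => // y; apply: coaction_ijE.
    by apply/esym/tensor_map_comp.
  rewrite coA.
  transitivity (tensor_map (proj_alghom K) (comul H) (DeltaP x)).
    by apply: tensor_map_comp => // h; apply: tensor_map_id.
  by apply/esym/tensor_map_comp.
transitivity (tensor_map (proj_alghom K) idfun
                (tensor_map idfun (counit H) (DeltaP x))).
  transitivity (tensor_map (proj_alghom K) (counit H) (DeltaP x)).
    exact: tensor_map_comp.
  by apply/esym/tensor_map_comp.
by rewrite counitP tensor_mapE.
Qed.

Lemma chi_ij_colinear : colinear coaction_ij chi_ij.
Proof.
move=> p; have [x <-] := proj_surj p; rewrite coaction_ijE chi_ijE.
transitivity (tensor_map base_restriction (tensor_map idfun idfun)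
   (tensor_assoc _ H H (tensor_map (chi i) idfun (DeltaP x)))).
  rewrite -tensor_assoc_map; congr (tensor_assoc _ _ _ _).
  transitivity (tensor_map chart_restriction idfun (DeltaP x)).
    by apply: tensor_map_comp => // y; apply: chi_ijE.
  by apply/esym/tensor_map_comp.
rewrite chi_colinear.
transitivity (tensor_map base_restriction (comul H) (chi i x)).
  by apply: tensor_map_comp => // h; apply: tensor_map_id.
by apply/esym/tensor_map_comp.
Qed.

Lemma chi_ij_bij : bijective chi_ij.
Proof.
have [s sP] := choice (chi_surj (i := i)).
(* Two preimages under [chi i] differ by an element of [K], so the arbitrary section [s] becomes
   linear after projection. *)
have proj_s p y : chi i p = y -> proj K (s y) = proj K p.
  move=> py; apply/eqP; rewrite proj_eq; apply: ideal_suml; apply/eqP.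
  by rewrite linearB sP py subrr.
have lin_inv0 : linear (fun y => proj K (s y)).
  move=> c x y; rewrite -linearP; apply: proj_s.
  by rewrite linearP !sP.
pose inv0 := linear_of lin_inv0.
(* [inv0] starts from B_i ⊗ H; to start from B_ij ⊗ H, the base factor is sent through [iota_ij] and
   only [1 \ox h] is lifted. *)
have inv_bilin : bilinear_fun (fun (a : quot L) (h : H) =>
    iota_ij a * inv0 ((1 : quot (J i)) \ox h)).
  split=> [h c a b|a c h k].
    by rewrite linearP mulrDl; congr (_ + _); apply: amulZl.
  rewrite tensDr tensZr linearP mulrDr; congr (_ + _); exact: amulZr.
pose inv : {linear _ -> _} := tensor_lift inv_bilin.
have invE a h : inv (a \ox h) = iota_ij a * inv0 ((1 : quot (J i)) \ox h).
  exact: tensor_liftE.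
have inv_restr y : inv (tensor_map base_restriction idfun y) = inv0 y.
  elim/tensor_ind: y => [a h|x y IHx IHy]; last by rewrite !linearD IHx IHy.
  have [b <-] := proj_surj a.
  rewrite tensor_mapE invE base_restrictionE iota_ijE.
  (* The product of [iota b] and the chosen lift of [1 \ox h] is a preimage of [proj (J i) b \ox h]
     under [chi i]. *)
  rewrite -(proj_morphism K).2; apply/esym/proj_s.
  rewrite (alghomP (chi i)).2 sP (qpfb_chi_iota hP).
  by rewrite [LHS]tensor_mulE mulr1 mul1r.
exists inv => [p|t].
  by have [x <-] := proj_surj p; rewrite chi_ijE inv_restr; apply: proj_s.
elim/tensor_ind: t => [a h|x y IHx IHy]; last by rewrite !linearD IHx IHy.
rewrite invE (alghomP chi_ij).2 chi_ij_iota_ij chi_ijE sP.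
rewrite tensor_mapE (alghomP base_restriction).1.
by rewrite [LHS]tensor_mulE mulr1 mul1r.
Qed.

Lemma coaction_ij_coinv f :
  (exists a, iota_ij a = f) <-> coaction_ij f = f \ox (1 : H).
Proof.
split=> [[a <-]|fc].
  have [x <-] := proj_surj a; rewrite iota_ijE coaction_ijE.
  have /(qpfb_coinv hP) -> : exists y, iota y = iota x by exists x.
  by rewrite tensor_mapE.
exists (ev (chi_ij f)); apply: (bij_inj chi_ij_bij); rewrite chi_ij_iota_ij.
(* Applying the counit to the middle factor of the colinearity identity for a coinvariant [f] gives
   [chi_ij f = ev (chi_ij f) \ox 1]. *)
have := contract_assoc (chi_ij f \ox (1 : H)).
have := chi_ij_colinear f; rewrite fc tensor_mapE => ->.
by rewrite contract_comul tensor_mapE => <-.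
Qed.
End Proposition.

Theorem proposition2 (R : realType) (H : hopfAlg R[i]) (B P : pzAlgType R[i])
    (DeltaP : alghom P (P ⊗ H)) (iota : alghom B P)
    (I : finType) (J : I -> ideal B)
    (chi : forall i : I, alghom P (quot (J i) ⊗ H))
    (hP : locally_trivial_QPFB DeltaP iota chi) (i j : I) :
  let Pij := quot (ideal_sum (ker_ideal (chi i)) (ker_ideal (chi j))) in
  let Bij := quot (ideal_sum (J i) (J j)) in
  exists (chi_ij : alghom Pij (Bij ⊗ H)) (DeltaPij : alghom Pij (Pij ⊗ H))
         (iota_ij : alghom Bij Pij),
    [/\ right_coaction DeltaPij,
        bijective chi_ij,
        injective iota_ij,
        colinear DeltaPij chi_ij &
        (forall a : Bij, chi_ij (iota_ij a) = a \ox (1 : H)) /\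
        (forall f : Pij,
           (exists a : Bij, iota_ij a = f) <-> DeltaPij f = f \ox (1 : H))].
Proof.
move=> Pij Bij; exists (chi_ij hP i j), (coaction_ij hP i j), (iota_ij hP i j).
split; first exact: coaction_ijP.
- exact: chi_ij_bij.
- exact: iota_ij_inj.
- exact: chi_ij_colinear.
- by split; [apply: chi_ij_iota_ij|apply: coaction_ij_coinv].
Qed.
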